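(* Let $A\in\mathrm{ASM}(n)$. Then $A$ is maximal in weak order on $\mathrm{ASM}(n)$ if and only if $A$ has an essential cell in each row except the last (i.e., in each of rows $1,\dots,n-1$).
   Context: $[n]=\{1,\dots,n\}$. An $n\times n$ alternating sign matrix (ASM) is a matrix $A=(A_{i,j})$ with entries in $\{-1,0,1\}$ such that $\sum_{j=1}^m A_{i,j}\in\{0,1\}$ for all $i,m\in[n]$, $\sum_{i=1}^m A_{i,j}\in\{0,1\}$ for all $j,m\in[n]$, and the sum of all entries is $n$; $\mathrm{ASM}(n)$ is the set of these. The corner sum function of $A$ is $\mathrm{rk}_A(i,j)=\sum_{a\in[i],\,b\in[j]}A_{a,b}$. Strong order on $\mathrm{ASM}(n)$: $A\le B$ iff $\mathrm{rk}_A(i,j)\ge \mathrm{rk}_B(i,j)$ for all $i,j\in[n]$. For $i\in[n-1]$, $\pi_i(A)$ is the minimum, in strong order, of $\{B\in\mathrm{ASM}(n): \mathrm{rk}_B(a,b)=\mathrm{rk}_A(a,b)\text{ for all }a,b\in[n]\text{ with }a\ne i\}$ (this minimum is known to exist). Weak order on $\mathrm{ASM}(n)$ is the transitive closure of the relations $\pi_i(A)\prec A$ for $i\in[n-1]$ with $\pi_i(A)\neq A$ (together with equality). $(i,j)\in[n]\times[n]$ is an inversion of $A$ if $\sum_{k=1}^jA_{i,k}=\sum_{l=1}^iA_{l,j}=0$; $\mathrm{inv}(A)$ is the set of inversions. The set of essential cells of $A$ is $\mathrm{ess}(A)=\{(i,j)\in\mathrm{inv}(A):(i+1,j)\notin\mathrm{inv}(A),\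 (i,j+1)\notin\mathrm{inv}(A)\}$; $(i,j)$ is a cell in row $i$. *)

(* Defs.v *)
From HB Require Import structures.
From mathcomp Require Import all_boot all_order all_algebra.
From Stdlib Require Import Relation_Operators.

Set Implicit Arguments.
Unset Strict Implicit.
Unset Printing Implicit Defensive.

Import Order.TTheory GRing.Theory Num.Theory.
Local Open Scope ring_scope.

(* The index set [n] is 'I_n, so rows and columns are numbered from 0: row k   *)
(* of the usual convention is i : 'I_n with i.+1 = k, a sum over the first k   *)
(* indices is a sum over the j <= i, and "k in [n-1]" reads (i.+1 < n)%N.      *)

Definition is_asm n (A : 'M[int]_n) : bool :=
  [&& [forall i, forall j, A i j \in [:: -1; 0; 1]],
      [forall i : 'I_n, forall m : 'I_n,
         \sum_(j < n | (j <= m)%N) A i j \in [:: 0; 1]],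
      [forall j : 'I_n, forall m : 'I_n,
         \sum_(i < n | (i <= m)%N) A i j \in [:: 0; 1]]
    & \sum_(i < n) \sum_(j < n) A i j == n%:Z].

Record asm (n : nat) := Asm { asm_mx :> 'M[int]_n; asm_mxP : is_asm asm_mx }.

HB.instance Definition _ n := [isSub for @asm_mx n].
HB.instance Definition _ n := [Choice of asm n by <:].

Section AlternatingSignMatrices.

Variable n : nat.
Implicit Types A B C : asm n.

Definition rk A (i j : 'I_n) : int :=
  \sum_(a < n | (a <= i)%N) \sum_(b < n | (b <= j)%N) A a b.

Definition strong_le A B : Prop := forall i j : 'I_n, rk B i j <= rk A i j.

Definition agree_off_row (i : 'I_n) A B : Prop :=
  forall a b : 'I_n, a != i -> rk B a b = rk A a b.

(* The graph of pi_i: B = pi_i(A). The strong order being antisymmetric, there *)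
(* is at most one such B.                                                      *)
Definition is_pi (i : 'I_n) A B : Prop :=
  agree_off_row i A B /\ forall C, agree_off_row i A C -> strong_le B C.

Definition weak_step B A : Prop :=
  exists i : 'I_n, [/\ (i.+1 < n)%N, is_pi i A B & B <> A].

Definition weak_le : asm n -> asm n -> Prop := clos_refl_trans (asm n) weak_step.

Definition weak_maximal A : Prop := forall B, weak_le A B -> B = A.

Definition inv A : {set 'I_n * 'I_n} :=
  [set p : 'I_n * 'I_n | (\sum_(k < n | (k <= p.2)%N) A p.1 k == 0)
         & (\sum_(l < n | (l <= p.1)%N) A l p.2 == 0)].

(* The neighbour (i+1, j) is quantified as (i', j) with i' = i + 1, so that it *)
(* counts as a non-inversion when i is the last row; likewise for (i, j+1).    *)
Definition ess A : {set 'I_n * 'I_n} :=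
  [set p : 'I_n * 'I_n in inv A |
     [forall i' : 'I_n, (i' == p.1.+1 :> nat) ==> ((i', p.2) \notin inv A)]
   & [forall j' : 'I_n, (j' == p.2.+1 :> nat) ==> ((p.1, j') \notin inv A)]].

End AlternatingSignMatrices.

(* Main.v *)
Require Import Defs.
From mathcomp Require Import all_boot all_order all_algebra.
From mathcomp Require Import zify.
From Stdlib Require Import Relation_Operators Operators_Properties.

(** Fix consecutive rows [i], [i' = i + 1].  Write [c] and [c'] for the sequences
of partial row sums of [A] along these rows, and [h] for the column sums of [A]
down to row [i]; all take their values in {0, 1}.

A matrix with the same corner sums as [A] off row [i] has there at [b] a corner
sum between those of rows [i - 1] and [i + 1] and at most one more than the
former.  So, if [c' <= c] pointwise, the corner sums of [A] in row [i] are as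
large as they can be, and [A] is the value of [pi_i] on its whole class.  In that
case exchanging the two rows of [A] gives another alternating sign matrix of the
class ([swap_asm]), so that [A] is not maximal.

If on the contrary [c] is 0 and [c'] is 1 somewhere, then row [i] contains an
essential cell ([ess_ex]).  Conversely let [(i, j)] be essential.  Then
[c j = 0], [c' j = 1], [h j = 0] and [h (j + 1) = 1] ([ess_cell]); these are
exactly the conditions under which adding the block with rows (1, -1), (-1, 1)
in rows [i, i + 1] and columns [j, j + 1] gives an alternating sign matrix
([flip_asm]).  This raises one corner sum in row [i], so [A] is not a value of
[pi_i].

Both modifications move a vector [d] from row [i + 1] to row [i] ([transfer]).
In all, [A] is of the form [pi_i C] with [C <> A] exactly when row [i] has no
essential cell, and [A] is maximal when this happens for no [i < n - 1]. *)

Set Implicit Arguments.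
Unset Strict Implicit.
Unset Printing Implicit Defensive.

Import Order.TTheory GRing.Theory Num.Theory.
Local Open Scope ring_scope.

(** * Partial sums *)

(** The bound is a natural number, and not an index, so that the empty sum is
included. *)
Definition psum n (f : 'I_n -> int) (m : nat) : int := \sum_(k < n | (k < m)%N) f k.

Section PartialSums.

Variable n : nat.
Implicit Types f g : 'I_n -> int.

Lemma psum0 f : psum f 0 = 0.
Proof. by rewrite /psum big_pred0. Qed.

Lemma psumS f (k : 'I_n) : psum f k.+1 = psum f k + f k.
Proof.
rewrite /psum (bigD1 k) //= addrC; congr (_ + _).
by apply: eq_bigl => x; rewrite ltnS ltn_neqAle andbC.
Qed.

Lemma psum_full f m : (n <= m)%N -> psum f m = \sum_k f k.
Proof.
by move=> le_nm; apply: eq_bigl => k; rewrite (leq_trans (ltn_ord k)).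
Qed.

Lemma eq_psum f g m : f =1 g -> psum f m = psum g m.
Proof. by move=> fg; apply: eq_bigr => k _. Qed.

Lemma psumD f g m : psum (fun k => f k + g k) m = psum f m + psum g m.
Proof. exact: big_split. Qed.

Lemma psumB f g m : psum (fun k => f k - g k) m = psum f m - psum g m.
Proof. exact: sumrB. Qed.

Lemma psum_delta (k : 'I_n) (c : int) m :
  psum (fun x => (x == k)%:R * c) m = (k < m)%N%:R * c.
Proof.
rewrite /psum; case: ltnP => km.
  rewrite (bigD1 k) //= eqxx big1 ?addr0 // => x /andP[_ /negPf ->].
  by rewrite mul0r.
rewrite mul0r big1 // => x xm; case: eqP => [xk|_]; last by rewrite mul0r.
by move: xm; rewrite xk ltnNge km.
Qed.

(** The partial sums of [delta_k - delta_k'] with [k' = k + 1]. *)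
Lemma ltn_deltaB (k k' : 'I_n) m : k' = k.+1 :> nat ->
  ((k < m)%N%:R - (k' < m)%N%:R : int) = (m == k.+1)%:R.
Proof. by move=> ->; case: (ltngtP m k.+1) => hm; do ?case: ltnP => ?; lia. Qed.

Lemma psum_bound f :
  (forall m : 'I_n, 0 <= psum f m.+1 <= 1) -> forall m, 0 <= psum f m <= 1.
Proof.
move=> fP; have small m : (m <= n)%N -> 0 <= psum f m <= 1.
  by case: m => [|m] mn; rewrite ?psum0 // (fP (Ordinal mn)).
move=> m; case: (leqP m n) => [/small //|/ltnW mn].
by rewrite psum_full // -(psum_full f (leqnn n)) small.
Qed.

End PartialSums.

(** * Alternating sign matrices through partial sums *)

Section AsmTheory.

Variable n : nat.
Implicit Types (A C : asm n) (M : 'M[int]_n).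

Lemma in01E (x : int) : (x \in [:: 0; 1]) = (0 <= x <= 1).
Proof. by rewrite !inE; apply/idP/idP => ?; lia. Qed.

(** An entry is the difference of two consecutive partial sums, so the bounds on
the partial sums put it in {-1, 0, 1}. *)
Lemma is_asmP M :
  reflect [/\ forall i m, 0 <= psum (M i) m <= 1,
              forall j m, 0 <= psum (fun i => M i j) m <= 1
            & \sum_i \sum_j M i j = n%:Z] (is_asm M).
Proof.
apply: (iffP idP) => [/and4P[_ rP cP /eqP sP]|[rP cP sP]].
  split=> // k; apply: psum_bound => m; rewrite -in01E.
    exact: (forallP (forallP rP k) m).
  exact: (forallP (forallP cP k) m).
apply/and4P; split; last by rewrite sP.
- apply/forallP=> i; apply/forallP=> j; rewrite !inE.
  by move: (rP i j) (rP i j.+1); rewrite psumS; lia.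
- by apply/forallP=> i; apply/forallP=> m; rewrite in01E; exact: rP i m.+1.
- by apply/forallP=> j; apply/forallP=> m; rewrite in01E; exact: cP j m.+1.
Qed.

Lemma asm_row A i m : 0 <= psum (A i) m <= 1.
Proof. by case/is_asmP: (asm_mxP A). Qed.

Lemma asm_col A j m : 0 <= psum (fun i => A i j) m <= 1.
Proof. by case/is_asmP: (asm_mxP A). Qed.

(** There are [n] row sums, each at most 1, and they add up to [n]. *)
Lemma asm_row_sum A i : psum (A i) n = 1.
Proof.
have /is_asmP[_ _ tot] := asm_mxP A.
have ge0 k : true -> 0 <= 1 - psum (A k) n by move: (asm_row A k n); lia.
suff /(psumr_eq0P ge0) /(_ i isT) : \sum_k (1 - psum (A k) n) = 0 by lia.
rewrite sumrB sumr_const card_ord.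
under [X in _ - X]eq_bigr => k _ do rewrite psum_full //.
by rewrite tot natz subrr.
Qed.

Lemma rk_psum A i j : rk A i j = psum (fun a => psum (A a) j.+1) i.+1.
Proof. by []. Qed.

Lemma agree_off_row_psum A C i (j : 'I_n) m : agree_off_row i A C ->
  (m <= n)%N -> m != i.+1 ->
  psum (fun a => psum (C a) j.+1) m = psum (fun a => psum (A a) j.+1) m.
Proof.
move=> agr; case: m => [|m] mn mi; first by rewrite !psum0.
by have := agr (Ordinal mn) j mi; rewrite !rk_psum.
Qed.

Lemma mem_inv A i j :
  ((i, j) \in Defs.inv A) =
  (psum (A i) j.+1 == 0) && (psum (fun a => A a j) i.+1 == 0).
Proof. by rewrite inE. Qed.

(** * Moving a vector between consecutive rows *)

Definition transfer (i i' : 'I_n) (d : 'I_n -> int) M : 'M[int]_n :=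
  \matrix_(a, b) (M a b + ((a == i)%:R * d b - (a == i')%:R * d b)).

Section Transfer.

Variables (i i' : 'I_n) (d : 'I_n -> int) (A : asm n).
Hypothesis ii' : i' = i.+1 :> nat.

Lemma transfer_row a m :
  psum (transfer i i' d A a) m =
  psum (A a) m + ((a == i)%:R * psum d m - (a == i')%:R * psum d m).
Proof.
rewrite (eq_psum _ (fun b => mxE _ _ a b)) psumD psumB.
by rewrite /psum !mulr_sumr.
Qed.

Lemma transfer_col b m :
  psum (fun a => transfer i i' d A a b) m =
  psum (fun a => A a b) m + (m == i.+1)%:R * d b.
Proof.
rewrite (eq_psum _ (fun a => mxE _ _ a b)) psumD psumB !psum_delta.
by rewrite -mulrBl (ltn_deltaB _ ii').
Qed.

Lemma transfer_corner j m :
  psum (fun a => psum (transfer i i' d A a) j.+1) m =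
  psum (fun a => psum (A a) j.+1) m + (m == i.+1)%:R * psum d j.+1.
Proof.
rewrite (eq_psum _ (fun a => transfer_row a _)) psumD psumB !psum_delta.
by rewrite -mulrBl (ltn_deltaB _ ii').
Qed.

Lemma transfer_is_asm :
  (forall m, 0 <= psum (A i) m + psum d m <= 1) ->
  (forall m, 0 <= psum (A i') m - psum d m <= 1) ->
  (forall b, 0 <= psum (fun a => A a b) i.+1 + d b <= 1) ->
  is_asm (transfer i i' d A).
Proof.
move=> di di' dc.
have neq : (i' == i) = false by apply/eqP => e; move: ii'; rewrite e; lia.
apply/is_asmP; split=> [a m|b m|].
- rewrite transfer_row; have [->|ai] := eqVneq a i.
    by rewrite eq_sym neq mul1r mul0r subr0.
  have [->|ai'] := eqVneq a i'; first by rewrite mul1r mul0r add0r.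
  by rewrite !mul0r subrr addr0 asm_row.
- rewrite transfer_col; have [->|mi] := eqVneq m i.+1; first by rewrite mul1r.
  by rewrite mul0r addr0 asm_col.
have /is_asmP[_ _ <-] := asm_mxP A.
rewrite exchange_big [RHS]exchange_big; apply: eq_bigr => b _.
rewrite -!(psum_full _ (leqnn n)) transfer_col.
case: eqP => [e|_]; last by rewrite mul0r addr0.
by move: (ltn_ord i'); rewrite ii' -e ltnn.
Qed.

End Transfer.

Lemma transfer_agree A C (i i' : 'I_n) d : i' = i.+1 :> nat ->
  C = transfer i i' d A :> 'M_n -> agree_off_row i A C.
Proof.
move=> ii' CE a b ai; rewrite !rk_psum CE transfer_corner //.
by rewrite eqSS (inj_eq val_inj) (negPf ai) mul0r addr0.
Qed.

(** * Rows whose partial sums dominate those of the next row *)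

(** After the exchange, a column sum down to row [i] can leave {0, 1} only where
the two exchanged entries are 1 and -1.  With 1 in row [i] and 0 above, the
partial sums of rows [i] and [i'] just before that column would be 0 and 1; with
-1 in row [i] and 1 above, they would be so at that column.  Both contradict the
comparison of the two rows. *)
Lemma swap_asm A (i i' : 'I_n) : i' = i.+1 :> nat ->
  (forall m, psum (A i') m <= psum (A i) m) ->
  is_asm (transfer i i' (fun b => A i' b - A i b) A).
Proof.
move=> ii' le; apply: transfer_is_asm => // [m|m|b].
- by rewrite psumB addrC subrK asm_row.
- by rewrite psumB opprB addrC subrK asm_row.
have := asm_col A b i; have := asm_col A b i'; have := asm_col A b i'.+1.
rewrite !psumS ii' psumS.
have := asm_row A i b; have := asm_row A i b.+1; have := asm_row A i' b.
have := asm_row A i' b.+1; have := le b; have := le b.+1.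
by rewrite !psumS; lia.
Qed.

(** Equal consecutive rows would have no entry 1, since a column sum cannot jump
by 2. *)
Lemma swap_neq A (i i' : 'I_n) : i' = i.+1 :> nat -> ~ (A i =1 A i').
Proof.
move=> ii' eqA.
have : psum (A i) n <= 0.
  apply: sumr_le0 => b _.
  have := asm_col A b i; have := asm_col A b i'.+1.
  by rewrite psumS ii' psumS -eqA; lia.
by rewrite asm_row_sum.
Qed.

(** Where the partial sum of [A] along row [i] is 1, its corner sum is one more
than in the row above, which is the most that [C] allows.  Where it is 0, so is
the one along row [i'], and the corner sum equals the one in the row below, an
upper bound for [C] again. *)
Lemma maximal_corner_sums A C (i i' : 'I_n) : i' = i.+1 :> nat ->
  (forall m, psum (A i') m <= psum (A i) m) ->
  agree_off_row i A C -> forall j, rk C i j <= rk A i j.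
Proof.
move=> ii' le agr j; rewrite !rk_psum.
have above :=
  agree_off_row_psum j agr (ltnW (ltn_ord i)) (negbT (ltn_eqF (ltnSn i))).
have := agree_off_row_psum j agr (ltn_ord i').
rewrite ii' eqSS gtn_eqF // => /(_ isT); rewrite -ii' !psumS ii' !psumS above.
have := asm_row C i j.+1; have := asm_row C i' j.+1.
have := asm_row A i j.+1; have := asm_row A i' j.+1; have := le j.+1.
by rewrite !psumS; lia.
Qed.

(** * Essential cells *)

Section EssentialCells.

Variables (A : asm n) (i i' : 'I_n).
Hypothesis ii' : i' = i.+1 :> nat.

(** If the partial sum of row [i'] at [j] were 0, the column sum down to [i'] would
be 1, because [(i', j)] is no inversion; so [A i' j = 1] and the partial sum just
before [j] would be -1.  Likewise, if the column sum down to row [i] were 0 at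
[j + 1], the partial sum of row [i] would be 1 there, so the entry would be 1 and
the column sum above it -1. *)
Lemma ess_cell j : (i, j) \in ess A ->
  [/\ psum (A i) j.+1 = 0, psum (A i') j.+1 = 1,
      psum (fun a => A a j) i.+1 = 0
    & exists2 j' : 'I_n, j' = j.+1 :> nat & psum (fun a => A a j') i.+1 = 1].
Proof.
rewrite inE => /and3P[].
rewrite mem_inv => /andP[/eqP r0 /eqP c0] /forallP /(_ i') /= below /forallP right.
have jn : (j.+1 < n)%N.
  (* the partial sum of a row is 1 at its end, so an inversion is not there *)
  rewrite ltn_neqAle ltn_ord andbT; apply/eqP => jn.
  have := asm_row_sum A i.
  by rewrite (psum_full _ (leqnn n)) -(@psum_full _ _ j.+1) ?r0 // jn.
have := right (Ordinal jn); rewrite /= eqxx /= mem_inv /= => nright.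
move: below; rewrite ii' eqxx /= mem_inv => nbelow; split=> //.
  move: nbelow; have := asm_row A i' j.+1; have := asm_row A i' j.
  by have := asm_col A j i'.+1; rewrite !psumS ii' c0; lia.
exists (Ordinal jn) => //; move: nright.
have := asm_row A i j.+2; have := asm_col A (Ordinal jn) i.
have := asm_col A (Ordinal jn) i.+1.
by rewrite (psumS (A i) (Ordinal jn)) /= r0 psumS; lia.
Qed.

(** The first column where the two partial sums are 0 and 1 is an inversion of row
[i], since a column sum 1 down to row [i] would give the same partial sums one
step to the left.  The last inversion of row [i] at which the partial sum of row
[i'] is 1 has no inversion on its right: that partial sum would drop to 0 there,
by an entry -1 below a column sum 0. *)
Lemma ess_ex (j0 : 'I_n) : psum (A i) j0.+1 = 0 -> psum (A i') j0.+1 = 1 ->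
  exists j, (i, j) \in ess A.
Proof.
move=> r0 r1.
pose P (j : 'I_n) := (psum (A i) j.+1 == 0) && (psum (A i') j.+1 == 1).
have Pj0 : P j0 by rewrite /P r0 r1 !eqxx.
have [j /andP[/eqP jr0 /eqP jr1] jmin] := arg_minnP (fun j : 'I_n => j : nat) Pj0.
have jinv : (i, j) \in Defs.inv A.
  rewrite mem_inv jr0 eqxx /=; apply: contraT => hj.
  have [pr0 pr1] : psum (A i) j = 0 /\ psum (A i') j = 1.
    have := asm_row A i j; have := asm_row A i' j; have := asm_col A j i'.+1.
    have := asm_col A j i.+1; have := asm_col A j i; move: jr0 jr1 hj.
    by rewrite !psumS ii' !psumS; split; lia.
  case: (posnP j) => [j_eq0|j_gt0]; first by move: pr1; rewrite j_eq0 psum0.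
  have pn : (j.-1 < n)%N by rewrite prednK // ltnW.
  have := jmin (Ordinal pn); rewrite /P /= prednK // pr0 pr1 !eqxx => /(_ isT).
  by rewrite -ltnS prednK // ltnn.
pose Q (k : 'I_n) := ((i, k) \in Defs.inv A) && (psum (A i') k.+1 == 1).
have Qj : Q j by rewrite /Q jinv jr1 eqxx.
have [k /andP[kinv /eqP kr1] kmax] := arg_maxnP (fun k : 'I_n => k : nat) Qj.
exists k; rewrite inE kinv /=; apply/andP; split.
  apply/forallP=> a; apply/implyP=> /eqP ai.
  have -> : a = i' by apply: val_inj; rewrite /= ai ii'.
  by rewrite mem_inv kr1.
apply/forallP=> k'; apply/implyP=> /= /eqP kk'; apply/negP=> k'inv.
have := kmax k'; rewrite /Q k'inv /= kk' ltnn => k'r1.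
have {}k'r1 : psum (A i') k'.+1 != 1 by rewrite kk'; apply/negP => /k'r1.
move: k'inv k'r1; rewrite mem_inv => /andP[_ /eqP].
have := asm_row A i' k'.+1; have := asm_col A k' i'.+1.
by rewrite !psumS kk' kr1 ii' !psumS; lia.
Qed.

(** Each partial sum that the block increases is 0, and each one that it decreases
is 1; all the others are unchanged. *)
Lemma flip_asm (j j' : 'I_n) : j' = j.+1 :> nat ->
  psum (A i) j.+1 = 0 -> psum (A i') j.+1 = 1 ->
  psum (fun a => A a j) i.+1 = 0 -> psum (fun a => A a j') i.+1 = 1 ->
  is_asm (transfer i i' (fun b => (b == j)%:R * 1 - (b == j')%:R * 1) A).
Proof.
move=> jj' r0 r1 c0 c1; apply: transfer_is_asm => // [m|m|b].
- rewrite psumB !psum_delta -mulrBl (ltn_deltaB _ jj').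
  by case: eqP => [->|_]; [rewrite r0|move: (asm_row A i m); lia].
- rewrite psumB !psum_delta -mulrBl (ltn_deltaB _ jj').
  by case: eqP => [->|_]; [rewrite r1|move: (asm_row A i' m); lia].
have [->|bj] := eqVneq b j.
  by rewrite c0; case: eqP => // e; move: jj'; rewrite -e; lia.
by have [->|_] := eqVneq b j'; [rewrite c1|move: (asm_col A b i.+1); lia].
Qed.

End EssentialCells.

(** The flip at an essential cell lies in the class of [A] and has a larger corner
sum, so that [A] is not lowest. *)
Lemma ess_not_pi A C (i i' j : 'I_n) : i' = i.+1 :> nat ->
  (i, j) \in ess A -> ~ is_pi i C A.
Proof.
move=> ii' /(ess_cell ii')[r0 r1 c0 [j' jj' c1]] [agr lowest].
pose D := Asm (flip_asm ii' jj' r0 r1 c0 c1).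
have agrD : agree_off_row i A D by apply: (@transfer_agree A D i i' _ ii').
have /lowest /(_ i j) : agree_off_row i C D by move=> a b ai; rewrite agrD // agr.
rewrite !rk_psum /= transfer_corner // eqxx mul1r.
by rewrite psumB !psum_delta -mulrBl (ltn_deltaB _ jj') eqxx; lia.
Qed.

Lemma no_ess_pi A (i i' : 'I_n) : i' = i.+1 :> nat ->
  (forall j, (i, j) \notin ess A) -> exists2 C, is_pi i C A & A <> C.
Proof.
move=> ii' noess.
have le m : psum (A i') m <= psum (A i) m.
  have := asm_row A i m; have := asm_row A i' m.
  case: (leqP m n) => [|/ltnW mn]; last first.
    by rewrite !(psum_full _ mn) -!(psum_full _ (leqnn n)) !asm_row_sum.
  case: m => [|m] mn; first by rewrite !psum0.
  case: (lerP (psum (A i') m.+1) (psum (A i) m.+1)) => // lt b' b.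
  have [||j jess] := @ess_ex A i i' ii' (Ordinal mn); rewrite /=; try lia.
  by have := noess j; rewrite jess.
pose C := Asm (swap_asm ii' le).
have agr : agree_off_row i A C by apply: (@transfer_agree A C i i' _ ii').
exists C; first split.
- by move=> a b ai; rewrite agr.
- move=> D agrD a b.
  have {}agrD : agree_off_row i A D by move=> x y xi; rewrite agrD // agr.
  have [->|ai] := eqVneq a i; first exact: maximal_corner_sums ii' le agrD b.
  by rewrite agrD.
move=> AC; apply: (swap_neq (A := A) ii') => b.
have : A i b = C i b by rewrite -AC.
rewrite mxE eqxx; case: eqP => [e|_]; first by have := ii'; rewrite -e; lia.
by rewrite mul1r mul0r; lia.
Qed.

(** A chain from [A] to another matrix begins with a strict step. *)
Lemma weak_maximalP A : weak_maximal A <-> forall C, ~ weak_step A C.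
Proof.
split=> [Amax C st|nostep C /(clos_rt_rt1n _ _ _ _)].
  by case: (st) => i [_ _]; rewrite (Amax C) //; exact: rt_step.
by case=> // D E /nostep.
Qed.

End AsmTheory.

Theorem corollary4p20 (n : nat) (A : asm n) :
  weak_maximal A <->
  (forall i : 'I_n, (i.+1 < n)%N -> exists j : 'I_n, (i, j) \in ess A).
Proof.
rewrite weak_maximalP; split=> [nostep i i1n|essA C [i [i1n piA _]]]; last first.
  by have [j jess] := essA i i1n; exact: (ess_not_pi (i' := Ordinal i1n) _ jess piA).
case: (boolP [exists j, (i, j) \in ess A]) => [/existsP //|/existsPn noess].
have [C piC AC] := no_ess_pi (i' := Ordinal i1n) erefl noess.
by case: (nostep C); exists i.
Qed.
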